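(* Let $\eta:\mathcal{S}_{E}(X)\to\mathcal{S}_{E}(X)$ be a mapping that satisfies the following properties, for all $\Omega_E, O_E\in\mathcal{S}_E(X)$: (1) $\eta(\Phi_{E})=\Phi_{E}$; (2) $\Omega_{E}\,\widetilde{\subseteq}\, \eta(\Omega_{E})$; (3) if $\Omega_{E}\,\widetilde{\subseteq}\, O_{E}$, then $\eta(\Omega_{E})\,\widetilde{\subseteq}\, \eta(O_{E})$; (4) $\eta(\eta(\Omega_{E}))=\eta(\Omega_{E})$; (5) if $\{(\Omega_{i},E): i\in I\}\subseteq \mathcal{S}_{E}(X)$ is a soft upward directed family, then $\eta\left(\widetilde{\bigcup}_{i\in I} (\Omega_{i},E)\right)=\widetilde{\bigcup}_{i\in I}\eta(\Omega_{i},E)$. Then the family $\zeta_{\eta}=\{\Omega_{E}\in\mathcal{S}_{E}(X):\eta(\Omega_{E})=\Omega_{E}\}$ is a soft convex structure on $X$ such that $\eta(\Omega_{E})=co(\Omega_{E})$ for all $\Omega_{E}\in\mathcal{S}_{E}(X)$, where $co$ is the soft convex hull operator on $(X,\zeta_\eta,E)$.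
   Context: $X$ is a nonempty set and $E$ a nonempty set of parameters. A soft set on $X$ is a pair $\Omega_E=(\Omega,E)$ with $\Omega:E\to\mathcal{P}(X)$ a function; $\mathcal{S}_E(X)$ is the family of all soft sets on $X$. $\Omega_E\,\widetilde{\subseteq}\,O_E$ means $\Omega(e)\subseteq O(e)$ for all $e\in E$. Unions $\widetilde{\bigcup}$ and intersections $\widetilde{\bigcap}$ of families of soft sets are taken parameterwise: $e\mapsto\bigcup_i\Omega_i(e)$, respectively $e\mapsto\bigcap_i\Omega_i(e)$. $\Phi_E$ is the soft set with value $\emptyset$ at every $e\in E$, and $X_E$ the soft set with value $X$ at every $e\in E$. A family $\{(\Omega_i,E):i\in I\}$ of soft sets on $X$ is soft upward directed if for each pair $i_1,i_2\in I$ there is $i_3\in I$ with $\Omega_{i_1}\,\widetilde{\subseteq}\,\Omega_{i_3}$ and $\Omega_{i_2}\,\widetilde{\subseteq}\,\Omega_{i_3}$. A family $\zeta\subseteq\mathcal{S}_E(X)$ is a soft convex structure on $X$ if: (i) $\Phi_E,X_E\in\zeta$; (ii) the intersection of each family of members of $\zeta$ belongs to $\zeta$; (iii) the union of each soft upward directed family of members of $\zeta$ belongs to $\zeta$. Then $(X,\zeta,E)$ is called a soft convex space. The soft convex hull operator on $(X,\zeta,E)$ is $co(\Omega_E)=\widetilde{\bigcap}\{O_E:\Omega_E\,\widetilde{\subseteq}\,O_E,\ O_E\in\zeta\}$. *)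

(* Defs.v *)
From mathcomp Require Import all_boot.
From mathcomp Require Import boolp classical_sets.

Set Implicit Arguments.
Unset Strict Implicit.
Unset Printing Implicit Defensive.

Local Open Scope classical_set_scope.

(* The parameter set E is fixed throughout, so the pair (Omega, E) is
   represented by the function Omega alone. *)
Definition soft_set (E X : Type) : Type := E -> set X.

Section SoftSets.
Variables (E X : Type).
Implicit Types A B : soft_set E X.

Definition soft_subset A B : Prop := forall e, A e `<=` B e.

Definition soft_empty : soft_set E X := fun=> set0.

Definition soft_full : soft_set E X := fun=> setT.

(* A family of soft sets is indexed by a set D of elements of an index type I;
   D may be empty, in which case the union is [soft_empty] and the
   intersection is [soft_full]. *)
Definition soft_bigcup (I : Type) (D : set I) (F : I -> soft_set E X) :
  soft_set E X := fun e => \bigcup_(i in D) F i e.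

Definition soft_bigcap (I : Type) (D : set I) (F : I -> soft_set E X) :
  soft_set E X := fun e => \bigcap_(i in D) F i e.

Definition soft_upward_directed (I : Type) (D : set I)
    (F : I -> soft_set E X) : Prop :=
  forall i1 i2, D i1 -> D i2 ->
    exists2 i3, D i3 & soft_subset (F i1) (F i3) /\ soft_subset (F i2) (F i3).

Record soft_convex_structure (zeta : set (soft_set E X)) : Prop := {
  soft_convex_empty : zeta soft_empty;
  soft_convex_full : zeta soft_full;
  soft_convex_bigcap : forall (I : Type) (D : set I) (F : I -> soft_set E X),
    (forall i, D i -> zeta (F i)) -> zeta (soft_bigcap D F);
  soft_convex_bigcup : forall (I : Type) (D : set I) (F : I -> soft_set E X),
    soft_upward_directed D F ->
    (forall i, D i -> zeta (F i)) -> zeta (soft_bigcup D F)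
}.

Definition soft_convex_hull (zeta : set (soft_set E X)) A : soft_set E X :=
  soft_bigcap [set B | soft_subset A B /\ zeta B] id.

Definition fixed_soft_sets (eta : soft_set E X -> soft_set E X) :
  set (soft_set E X) := [set A | eta A = A].

End SoftSets.

Arguments soft_empty {E X}.
Arguments soft_full {E X}.

(* Main.v *)
Require Import Defs.
From mathcomp Require Import all_boot.
From mathcomp Require Import boolp classical_sets.

Local Open Scope classical_set_scope.

(** The fixed points of a closure operator [eta] on the complete lattice of soft
    sets form a closure system: an intersection of fixed points is fixed because
    monotonicity puts its image below each member of the family, and [eta A] is
    the least fixed point above [A], being fixed by idempotence and below every
    other such fixed point by monotonicity.  This yields stability under
    intersections ([fixed_soft_bigcap]) and the identification of [eta] with the
    hull ([closure_is_soft_convex_hull]).  The full soft set is fixed because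
    [eta] is extensive, the empty one by assumption, and a directed union of
    fixed points because [eta] commutes with directed unions. *)

Lemma soft_subset_anti (E X : Type) (A B : soft_set E X) :
  soft_subset A B -> soft_subset B A -> A = B.
Proof. by move=> AB BA; apply/funext => e; apply/seteqP; split. Qed.

Lemma soft_bigcap_lower_bound (E X I : Type) (D : set I)
    (F : I -> soft_set E X) i :
  D i -> soft_subset (soft_bigcap D F) (F i).
Proof. by move=> Di e x; apply. Qed.

Lemma soft_bigcap_greatest (E X I : Type) (D : set I)
    (F : I -> soft_set E X) (A : soft_set E X) :
  (forall i, D i -> soft_subset A (F i)) -> soft_subset A (soft_bigcap D F).
Proof. by move=> AF e x Ax i Di; exact: AF. Qed.

Lemma eq_soft_bigcup (E X I : Type) (D : set I) (F G : I -> soft_set E X) :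
  (forall i, D i -> F i = G i) -> soft_bigcup D F = soft_bigcup D G.
Proof.
by move=> FG; apply/funext => e; apply: eq_bigcupr => i Di; rewrite FG.
Qed.

(** By monotonicity the image of the intersection lies below the image of each
    member, which is that member; hence it lies below the intersection. *)
Lemma fixed_soft_bigcap (E X : Type) (eta : soft_set E X -> soft_set E X)
    (eta_ext : forall A, soft_subset A (eta A))
    (eta_mono : forall A B, soft_subset A B -> soft_subset (eta A) (eta B))
    (I : Type) (D : set I) (F : I -> soft_set E X) :
  (forall i, D i -> fixed_soft_sets eta (F i)) ->
  fixed_soft_sets eta (soft_bigcap D F).
Proof.
move=> fixF; apply: soft_subset_anti; last exact: eta_ext.
apply: soft_bigcap_greatest => i Di; rewrite -(fixF i Di).
by apply: eta_mono; exact: soft_bigcap_lower_bound.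
Qed.

(** [eta A] is itself one of the soft sets intersected in the hull of [A], and
    monotonicity makes it the smallest of them. *)
Lemma closure_is_soft_convex_hull (E X : Type)
    (eta : soft_set E X -> soft_set E X)
    (eta_ext : forall A, soft_subset A (eta A))
    (eta_mono : forall A B, soft_subset A B -> soft_subset (eta A) (eta B))
    (eta_idem : forall A, eta (eta A) = eta A) (A : soft_set E X) :
  eta A = soft_convex_hull (fixed_soft_sets eta) A.
Proof.
apply: soft_subset_anti.
- by apply: soft_bigcap_greatest => B [AB <-]; exact: eta_mono.
- by apply: (@soft_bigcap_lower_bound _ _ _ _ id); split;
    [exact: eta_ext | exact: eta_idem].
Qed.

Theorem theorem3p1 (X E : Type) (X_neq0 : [set: X] !=set0)
  (E_neq0 : [set: E] !=set0) (eta : soft_set E X -> soft_set E X)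
  (eta_empty : eta soft_empty = soft_empty)
  (eta_ext : forall A : soft_set E X, soft_subset A (eta A))
  (eta_mono : forall A B : soft_set E X,
    soft_subset A B -> soft_subset (eta A) (eta B))
  (eta_idem : forall A : soft_set E X, eta (eta A) = eta A)
  (eta_directed : forall (I : Type) (D : set I) (F : I -> soft_set E X),
    soft_upward_directed D F ->
    eta (soft_bigcup D F) = soft_bigcup D (fun i => eta (F i))) :
  soft_convex_structure (fixed_soft_sets eta) /\
  (forall A : soft_set E X,
    eta A = soft_convex_hull (fixed_soft_sets eta) A).
Proof.
split; last exact: closure_is_soft_convex_hull.
split.
- exact: eta_empty.
- by apply: soft_subset_anti; [move=> e x | exact: eta_ext].
- by move=> I D F; exact: fixed_soft_bigcap.
- move=> I D F dirF fixF; rewrite /fixed_soft_sets /= eta_directed //.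
  exact: eq_soft_bigcup.
Qed.
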